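(* Suppose the parallel server system satisfies the relaxed heavy traffic condition and the relaxed complete resource pooling condition, and let $(v,u)$ be the unique optimal dual LP solution. Let $T_k(z)=W_k(z)/u_k$, and let $T_{(1)}(z)\le\cdots\le T_{(K)}(z)$ be the values $\{T_k(z):k\in\mathcal{K}\}$ in increasing order. Under the WWTA policy and a non-idling scheduling policy $\mathcal{P}$, there is a constant $r_0\in(0,1)$ such that for each $n\in\mathbb{Z}_+$ there exists a constant $M_n>0$ with $$\mathbb{E}\Big[\big(T_{(K)}(Z^{(r)})-T_{(1)}(Z^{(r)})\big)^n\Big]\le M_n\qquad\text{for all } r\in(0,r_0).$$ (The constant $r_0$ does not depend on $n$.)
   Context: Model. Job classes $\mathcal{I}=\{1,\ldots,I\}$, servers $\mathcal{K}=\{1,\ldots,K\}$, and a set $\mathcal{J}\subset\mathcal{I}\times\mathcal{K}$ of $J$ activities ($(i,k)\in\mathcal{J}$ means server $k$ can process class $i$). $\mathcal{I}(k)=\{i:(i,k)\in\mathcal{J}\}$, $\mathcal{K}(i)=\{k:(i,k)\in\mathcal{J}\}$. Class $i$ has nominal arrival rate $\lambda_i>0$ (Poisson arrivals); service times for activity $(i,k)$ are exponential with mean $m_{ik}=1/\mu_{ik}$, $\mu_{ik}>0$. LP (static allocation problem): minimize $\rho$ over $x=(x_{ik})_{(i,k)\in\mathcal{J}}\ge 0$, $\rho\ge0$, subject to $\sum_{k\in\mathcal{K}(i)}\mu_{ik}x_{ik}=\lambda_i$ for all $i$, and $\sum_{i\in\mathcal{I}(k)}x_{ik}\le\rho$ for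 all $k$. Dual LP: maximize $\sum_i\lambda_iv_i$ over $v\in\mathbb{R}^I$, $u\in\mathbb{R}^K$, $u\ge0$, subject to $\mu_{ik}v_i\le u_k$ for all $(i,k)\in\mathcal{J}$ and $\sum_ku_k\le1$. Relaxed heavy traffic condition: the LP has an optimal solution $(x^*,\rho^* )$ (not necessarily unique) with $\rho^*=1$ and $\sum_{i\in\mathcal{I}(k)}x^*_{ik}=1$ for every $k$. Activity $(i,k)$ is basic associated with such an $x^*$ if $x^*_{ik}>0$. Servers $k,k'$ communicate directly if for some such $x^*$ and some class $i$ both $(i,k)$ and $(i,k')$ are basic activities associated with $x^*$; servers $k,k'$ communicate if there is a sequence $k=k_1,\ldots,k_\omega=k'$ with consecutive servers communicating directly. Relaxed complete resource pooling condition: such an $x^*$ exists and all servers communicate (different links may use different optimal $x^*$). Under these two conditions the dual LP has a unique optimal solution $(v,u)$, with all $u_k>0$, $v_i>0$. Policies. A state is $z=(z_{ik})_{(i,k)\in\mathcal{J}}\in\mathbb{Z}_+^J$, $z_{ik}$ being the number of jobs in buffer $(i,k)$ (including in service). Workload: $W_k(z)=\sum_{i\in\mathcal{I}(k)}m_{ik}z_{ik}$. WWTA routing: a class $i$ arrival in state $z$ is immediately routed to server $L^{(i)}(z)$, the smallest index in $\arg\min_{k\in\mathcal{K}(i)}m_{ik}W_k(z)$. A non-idling scheduling policy $\mathcal{P}=(P_{ik}(z))$ gives the fraction $P_{ik}(z)\in[0,1]$ of effort of server $k$ devoted to class $i$ in state $z$, with $P_{ik}(z)=0$ if $z_{ik}=0$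 and $\sum_{i\in\mathcal{I}(k)}P_{ik}(z)=1$ whenever $\sum_{i\in\mathcal{I}(k)}z_{ik}>0$. Sequence of systems. For $r\in(0,1)$, the $r$th system has arrival rates $\lambda_i^{(r)}=\lambda_i(1-r)$, other parameters unchanged. Its queue length process is the continuous-time Markov chain on $\mathbb{Z}_+^J$ with generator $$Gf(z)=\sum_{i}\lambda_i^{(r)}\sum_{k\in\mathcal{K}(i)}[f(z+e_{ik})-f(z)]\mathbf{1}(k=L^{(i)}(z))+\sum_k\sum_{i\in\mathcal{I}(k)}\mu_{ik}P_{ik}(z)[f(z-e_{ik})-f(z)],$$ $e_{ik}$ the unit vectors. For each $r\in(0,1)$ it has a unique stationary distribution; $Z^{(r)}$ denotes a random vector with this distribution. *)

(* Defs.v *)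
From HB Require Import structures.
From mathcomp Require Import all_boot all_order all_algebra.
From mathcomp Require Import all_classical all_reals all_analysis.

Set Implicit Arguments.
Unset Strict Implicit.
Unset Printing Implicit Defensive.

Import Order.TTheory GRing.Theory Num.Theory.
Import numFieldNormedType.Exports.

Local Open Scope classical_set_scope.
Local Open Scope ring_scope.

Section Markov.
Context (d : measure_display) (T : measurableType d) (R : realType).

(* [p t x] is the law at time [t] of the process started at [x]; the values at
   negative times are irrelevant. *)
Definition markov_semigroup (p : R -> T -> probability T R) : Prop :=
  (forall (x : T) (A : set T), measurable A -> p 0 x A = \d_x A) /\
  (forall (s t : R) (x : T) (A : set T), 0 <= s -> 0 <= t -> measurable A ->
     p (s + t) x A = (\int[p s x]_y p t y A)%E).

Definition has_generator (G : (T -> R) -> T -> R)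
    (p : R -> T -> probability T R) : Prop :=
  forall f : T -> R, measurable_fun [set: T] f -> bounded_fun f ->
  forall x : T,
    (fun t : R => t^-1 * ((\int[p t x]_y f y) - f x)) @ 0^'+ --> G f x.

Definition invariant_law (p : R -> T -> probability T R)
    (pi : probability T R) : Prop :=
  forall (t : R) (A : set T), 0 <= t -> measurable A ->
    (\int[pi]_x p t x A)%E = pi A.

Definition stationary_distribution (G : (T -> R) -> T -> R)
    (pi : probability T R) : Prop :=
  exists p : R -> T -> probability T R,
    [/\ markov_semigroup p, has_generator G p & invariant_law p pi].

End Markov.

Record parallel_server_system (R : realType) := ParallelServerSystem {
  nclass : nat;
  nserver : nat;
  activities : {set 'I_nclass * 'I_nserver};
  arrival : 'I_nclass -> R;
  service : {a : 'I_nclass * 'I_nserver | a \in activities} -> R;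
  arrival_gt0 : forall i, 0 < arrival i;
  service_gt0 : forall a, 0 < service a }.

Section System.
Context (R : realType) (S : parallel_server_system R).

Definition activity := {a : 'I_(nclass S) * 'I_(nserver S) | a \in activities S}.

Definition cls (a : activity) : 'I_(nclass S) := (val a).1.
Definition srv (a : activity) : 'I_(nserver S) := (val a).2.

Definition mean_service (a : activity) : R := (service a)^-1.

Definition lp_feasible (x : activity -> R) (rho : R) : Prop :=
  [/\ forall a, 0 <= x a,
      0 <= rho,
      forall i, \sum_(a | cls a == i) service a * x a = arrival i
    & forall k, \sum_(a | srv a == k) x a <= rho].

Definition lp_optimal (x : activity -> R) (rho : R) : Prop :=
  lp_feasible x rho /\
  forall (y : activity -> R) (sigma : R), lp_feasible y sigma -> rho <= sigma.

Definition dual_feasible (v : 'I_(nclass S) -> R) (u : 'I_(nserver S) -> R)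
    : Prop :=
  [/\ forall k, 0 <= u k,
      forall a, service a * v (cls a) <= u (srv a)
    & \sum_k u k <= 1].

Definition dual_optimal (v : 'I_(nclass S) -> R) (u : 'I_(nserver S) -> R)
    : Prop :=
  dual_feasible v u /\
  forall v' u', dual_feasible v' u' ->
    \sum_i arrival i * v' i <= \sum_i arrival i * v i.

Definition heavy_traffic_allocation (x : activity -> R) : Prop :=
  lp_optimal x 1 /\ forall k, \sum_(a | srv a == k) x a = 1.

Definition relaxed_heavy_traffic : Prop :=
  exists x : activity -> R, heavy_traffic_allocation x.

Definition basic (x : activity -> R) (a : activity) : Prop := 0 < x a.

Definition communicate_directly (k k' : 'I_(nserver S)) : Prop :=
  exists x : activity -> R, heavy_traffic_allocation x /\
  exists a b : activity,
    [/\ cls a = cls b, srv a = k, srv b = k', basic x a & basic x b].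

Definition communicate (k k' : 'I_(nserver S)) : Prop :=
  connect (fun k1 k2 => `[< communicate_directly k1 k2 >]) k k'.

Definition relaxed_complete_resource_pooling : Prop :=
  (exists x : activity -> R, heavy_traffic_allocation x) /\
  forall k k', communicate k k'.

Definition state := {ffun activity -> nat}.

HB.instance Definition _ := Countable.on state.
HB.instance Definition _ := isPointed.Build state [ffun=> 0%N].
HB.instance Definition _ := @isMeasurable.Build default_measure_display
  state (@discrete_measurable state) discrete_measurable0
  discrete_measurableC discrete_measurableU.

Definition incr (z : state) (a : activity) : state :=
  [ffun b => (z b + (b == a))%N].

(* Truncated at 0; the generator below only uses it with a zero coefficient
   when [z a = 0], because a policy gives no effort to an empty buffer. *)
Definition decr (z : state) (a : activity) : state :=
  [ffun b => (z b - (b == a))%N].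

Definition workload (k : 'I_(nserver S)) (z : state) : R :=
  \sum_(a | srv a == k) mean_service a * (z a)%:R.

Definition weighted_workload (a : activity) (z : state) : R :=
  mean_service a * workload (srv a) z.

Definition wwta_argmin (i : 'I_(nclass S)) (z : state) : {set activity} :=
  [set a | (cls a == i) &&
     [forall (b | cls b == i), weighted_workload a z <= weighted_workload b z]].

(* The server with smallest index in the arg min, given as the activity linking
   it to class [i]; it is [None] only if no server can process class [i]. *)
Definition wwta (i : 'I_(nclass S)) (z : state) : option activity :=
  [pick a in wwta_argmin i z |
     [forall b in wwta_argmin i z, (srv a <= srv b)%N]].

Record scheduling_policy := SchedulingPolicy {
  effort : state -> activity -> R;
  effort_itv : forall z a, 0 <= effort z a <= 1;
  effort_empty : forall (z : state) a, z a = 0%N -> effort z a = 0;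
  effort_nonidling : forall (z : state) k,
    (0 < \sum_(a | srv a == k) z a)%N -> \sum_(a | srv a == k) effort z a = 1 }.

Definition arrival_r (r : R) (i : 'I_(nclass S)) : R := arrival i * (1 - r).

Definition wwta_generator (P : scheduling_policy) (r : R) (f : state -> R)
    (z : state) : R :=
  \sum_i arrival_r r i *
    (\sum_(a | cls a == i) (f (incr z a) - f z) * (Some a == wwta i z)%:R) +
  \sum_k \sum_(a | srv a == k)
    service a * effort P z a * (f (decr z a) - f z).

Definition scaled_workload (u : 'I_(nserver S) -> R) (z : state)
    (k : 'I_(nserver S)) : R := workload k z / u k.

(* [T_(j)], for [1 <= j <= nserver S] *)
Definition ordered_workload (u : 'I_(nserver S) -> R) (j : nat) (z : state) : R :=
  nth 0 (sort <=%R [seq scaled_workload u z k | k <- enum 'I_(nserver S)]) j.-1.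

End System.

(* Main.v *)
Require Import Defs.
From mathcomp Require Import all_boot all_order all_algebra.
From mathcomp Require Import all_classical all_reals all_analysis.
From mathcomp Require Import ring lra.

Set Implicit Arguments.
Unset Strict Implicit.
Unset Printing Implicit Defensive.

Import Order.TTheory GRing.Theory Num.Theory.
Local Open Scope ring_scope.

(** LP duality and complementary slackness give [sum_k u_k = sum_i lambda_i v_i
    = 1] and [mu_ik v_i = u_k] on basic activities. With [W] the workload
    vector, let [slack = sum_k W_k - sum_i lambda_i min_k m_ik W_k]. For every
    heavy traffic allocation [x] it equals
    [sum_ik mu_ik x_ik (m_ik W_k - min_k' m_ik' W_k')], so it controls
    [|T_k - T_k'|] for directly communicating servers, hence for all pairs.

    Let [q] be the squared distance of [W] to the line spanned by [u], that is,
    [|W|^2 - (u . W)^2 / |u|^2]. Since WWTA minimizes [m_ik W_k] and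
    [m_ik u_k >= v_i], the drift of [q] is at most
    [- 2 (1 - r) slack + 2 r C slack + const], thus at most [- slack + const]
    as soon as [r] is small. As [slack] dominates the distance to the line, the
    function [sqrt (1 + q)], whose jumps are bounded, has uniformly negative
    drift away from its minimum, so it has an exponential moment bounded
    uniformly in [r]. That last step tests stationarity on truncated
    exponentials, for which [int G f dpi = 0]. *)

(** * Linear programming duality *)

Lemma sum_fiber (R : nmodType) (A I : finType) (p : A -> I) (F : I -> A -> R) :
  \sum_i \sum_(a | p a == i) F i a = \sum_a F (p a) a.
Proof.
rewrite [RHS](partition_big p predT)//=.
by apply: eq_bigr => i _; apply: eq_bigr => a /eqP ->.
Qed.

Lemma sum_delta (R : pzSemiRingType) (A : finType) (P : pred A) (a0 : A)
    (F : A -> R) :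
  \sum_(a | P a) F a * (a == a0)%:R = F a0 * (P a0)%:R.
Proof.
case: (boolP (P a0)) => [Pa0|/negP nP].
- rewrite (bigD1 a0)//= eqxx mulr1 big1 ?addr0 ?mulr1// => a /andP[_ /negPf->].
  by rewrite mulr0.
- rewrite mulr0 big1// => a Pa; case: eqP => [E|_]; last by rewrite mulr0.
  by rewrite -E in nP.
Qed.

(* Bartl's induction: if dropping [a i0] breaks the implication at a vector
   [z], normalized by [a i0 z = 1], project along [z] onto the kernel of
   [a i0]. *)
Lemma farkas_seq (R : realFieldType) (V : lmodType R) (I : eqType) (s : seq I) :
  uniq s -> forall (a : I -> V -> R) (b : V -> R),
  (forall i, scalar (a i)) -> scalar b ->
  (forall x, (forall i, i \in s -> a i x <= 0) -> b x <= 0) ->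
  exists2 w : I -> R, (forall i, 0 <= w i) &
    forall x, b x = \sum_(i <- s) w i * a i x.
Proof.
have lin0 (f : V -> R) : scalar f -> f 0 = 0.
  by move=> /(_ (-1) 0 0); rewrite scaler0 addr0 => ->; rewrite mulN1r addNr.
have linZ (f : V -> R) c x : scalar f -> f (c *: x) = c * f x.
  by move=> fl; have := fl c x 0; rewrite (lin0 f fl) !addr0.
elim: s => [_|i0 s IH /= /andP[i0s us]] a b la lb H.
  exists (fun=> 0) => // x; rewrite big_nil.
  (* With no constraint [b] is nonpositive everywhere; applying this at [-x] as well forces
     [b = 0]. *)
  apply/eqP; rewrite eq_le H//= -oppr_le0 -mulN1r -linZ// H//.
have [H'|/existsNP[z /not_implyP[Hz /negP]]] :=
  pselect (forall x, (forall i, i \in s -> a i x <= 0) -> b x <= 0).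
  have [w w0 bw] := IH us a b la lb H'.
  exists (fun i => if i == i0 then 0 else w i) => [i|x]; first by case: ifP.
  rewrite big_cons eqxx mul0r add0r bw.
  apply: eq_big_seq => i si; case: eqP => // ii0.
  by rewrite -ii0 si in i0s.
rewrite -ltNge => bz.
have az : 0 < a i0 z.
  rewrite ltNge; apply/negP => az; suff : b z <= 0 by rewrite leNgt bz.
  by apply: H => i; rewrite inE => /predU1P[->//|]; exact: Hz.
pose y := (a i0 z)^-1 *: z.
have ay : a i0 y = 1 by rewrite linZ// mulVf// gt_eqF.
have by0 : 0 < b y by rewrite linZ// mulr_gt0// invr_gt0.
have aiy i : i \in s -> a i y <= 0.
  by move=> si; rewrite linZ// pmulr_rle0 ?invr_gt0// Hz.
have linB (f : V -> R) c x : scalar f -> f (x - c *: y) = f x - c * f y.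
  by move=> fl; rewrite addrC -scaleNr fl; lra.
pose a' i x := a i x - a i0 x * a i y.
pose b' x := b x - a i0 x * b y.
have [||x Hx|w w0 bw] := IH us a' b'.
- by move=> i c u v; rewrite /a' !la; lra.
- by move=> c u v; rewrite /b' la lb; lra.
- rewrite /b' -linB//; apply: H => i; rewrite inE => /predU1P[->|si].
    by rewrite linB// ay mulr1 subrr.
  by rewrite linB//; exact: Hx.
(* The weight of [i0] collects the multiples of [a i0 x] that appear when [a'] and [b'] are
   expanded. It is nonnegative because [b y > 0] while [a j y <= 0] for [j] in [s]. *)
exists (fun i => if i == i0 then b y - \sum_(j <- s) w j * a j y else w i).
  move=> i; case: ifP => // _.
  rewrite subr_ge0 (le_trans _ (ltW by0))// big_seq sumr_le0// => j sj.
  by rewrite mulr_ge0_le0// aiy.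
move=> x; rewrite big_cons eqxx.
have -> : b x = b' x + a i0 x * b y by rewrite /b'; lra.
rewrite bw /a' mulrBl.
have -> : \sum_(i <- s) w i * (a i x - a i0 x * a i y) =
  \sum_(i <- s) w i * a i x - (\sum_(j <- s) w j * a j y) * a i0 x.
  rewrite mulr_suml -sumrB; apply: eq_bigr => i _; lra.
have -> : \sum_(j <- s)
    (if j == i0 then b y - \sum_(j <- s) w j * a j y else w j) * a j x =
    \sum_(i <- s) w i * a i x.
  apply: eq_big_seq => i si; case: eqP => // ii0.
  by rewrite -ii0 si in i0s.
lra.
Qed.

Lemma farkas (R : realFieldType) (V : lmodType R) (I : finType)
    (a : I -> V -> R) (b : V -> R) :
  (forall i, scalar (a i)) -> scalar b ->
  (forall x, (forall i, a i x <= 0) -> b x <= 0) ->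
  exists2 w : I -> R, (forall i, 0 <= w i) & forall x, b x = \sum_i w i * a i x.
Proof.
move=> la lb H; apply: farkas_seq (index_enum_uniq I) _ _ la lb _ => x Hx.
by apply: H => i; apply: Hx; rewrite mem_index_enum.
Qed.

Section LP.
Context (R : realType) (S : parallel_server_system R).

Let J := {a : 'I_(nclass S) * 'I_(nserver S) | a \in activities S}.

(* Farkas applied to the cone over the primal feasible set, whose points are
   [(x, t, rho)] with [t] scaling the arrival rates. *)
Lemma dual_value_ge (x0 : activity S -> R) : lp_optimal x0 1 ->
  exists v u, @dual_feasible R S v u /\ 1 <= \sum_i arrival i * v i.
Proof.
move=> [_ opt].
pose V := ({ffun J -> R^o} * R^o * R^o)%type.
pose flow (i : 'I_(nclass S)) (x : V) : R :=
  \sum_(a : J | cls a == i) service a * x.1.1 a - arrival i * x.1.2.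
pose load (k : 'I_(nserver S)) (x : V) : R :=
  \sum_(a : J | srv a == k) x.1.1 a - x.2.
(* The flow equation enters twice, once with each sign. The last boolean stands for [t >= 0] when
   [true] and for [rho >= 0] when [false]. *)
pose I := (J + (bool * 'I_(nclass S)) + 'I_(nserver S) + bool)%type.
pose f (j : I) (x : V) : R := match j with
  | inl (inl (inl a)) => - x.1.1 a
  | inl (inl (inr (s, i))) => (-1) ^+ s * flow i x
  | inl (inr k) => load k x
  | inr s => if s then - x.1.2 else - x.2
  end.
have flow_lin i : scalar (flow i).
  move=> c y z; rewrite /flow /= mulrBr mulr_sumr.
  under eq_bigr => a _ do rewrite !ffunE mulrDr mulrCA.
  rewrite big_split/= /GRing.scale /=; lra.
have load_lin i : scalar (load i).
  move=> c y z; rewrite /load /= mulrBr mulr_sumr.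
  under eq_bigr => a _ do rewrite !ffunE.
  rewrite big_split/= /GRing.scale /=; lra.
have f_lin j : scalar (f j).
  move=> c y z; case: j => [[[a|[s i]]|k]|[]] //=.
  - by rewrite !ffunE /GRing.scale/=; lra.
  - by rewrite flow_lin; lra.
  - exact: load_lin.
  - by rewrite /GRing.scale/=; lra.
  - by rewrite /GRing.scale/=; lra.
pose b (x : V) : R := x.1.2 - x.2.
have b_lin : scalar b.
  by move=> c y z; rewrite /b /= /GRing.scale /=; lra.
have [x Hx|w w0 bw] := @farkas R V I f b f_lin b_lin.
  have x_ge0 a : 0 <= x.1.1 a by have := Hx (inl (inl (inl a))); rewrite /f /=; lra.
  have xflow i : \sum_(a : J | cls a == i) service a * x.1.1 a = arrival i * x.1.2.
    have := Hx (inl (inl (inr (true, i)))); have := Hx (inl (inl (inr (false, i)))).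
    by rewrite /= /flow expr0 expr1; lra.
  have xload k : \sum_(a : J | srv a == k) x.1.1 a <= x.2.
    by have := Hx (inl (inr k)); rewrite /= /load; lra.
  have rho0 : 0 <= x.2 by have := Hx (inr false); rewrite /=; lra.
  have : 0 <= x.1.2 by have := Hx (inr true); rewrite /=; lra.
  (* For [t = 0] the claim reduces to [rho >= 0]. Otherwise dividing by [t] gives a feasible point
     of the LP, so [rho / t] is at least the optimal value 1. *)
  rewrite le_eqVlt => /predU1P[t0|t0]; first by rewrite /b -t0; lra.
  rewrite /b subr_le0 -[X in X <= _]mul1r -ler_pdivlMr//.
  apply: (opt (fun a => x.1.1 a / x.1.2)); split.
  - by move=> a; rewrite divr_ge0// ltW.
  - by rewrite divr_ge0// ltW.
  - move=> i; under eq_bigr => a _ do rewrite mulrA.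
    by rewrite -mulr_suml xflow mulfK// gt_eqF.
  - by move=> k; rewrite -mulr_suml ler_pM2r ?invr_gt0.
(* A difference of the multipliers of the two signed copies of the flow equation, hence of free
   sign. *)
pose v i := w (inl (inl (inr (true, i)))) - w (inl (inl (inr (false, i)))).
pose u k := w (inl (inr k)).
have bE (x : V) : b x = - (\sum_a w (inl (inl (inl a))) * x.1.1 a)
    - (\sum_i v i * flow i x) + \sum_k u k * load k x
    - w (inr true) * x.1.2 - w (inr false) * x.2.
  rewrite bw !big_sumType /= big_bool /=.
  pose F s i := w (inl (inl (inr (s, i)))) * ((-1) ^+ s * flow i x).
  rewrite [X in _ + X + _ + _](eq_bigr (fun p => F p.1 p.2)); last by case.
  rewrite -(pair_bigA _ F) big_bool /= -big_split /=.
  have -> : \sum_i (F true i + F false i) = - \sum_i v i * flow i x.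
    by rewrite -sumrN; apply: eq_bigr => i _; rewrite /F /v expr0 expr1; lra.
  rewrite (eq_bigr (fun a => - (w (inl (inl (inl a))) * x.1.1 a))); last first.
    by move=> a _; rewrite mulrN.
  by rewrite sumrN; lra.
(* The identity [bE] at the unit vector of an activity gives the dual constraint of that activity,
   in the [rho] direction it gives [\sum_k u k <= 1], and in the [t] direction it gives the value
   bound; each time the slack is a nonnegative multiplier. *)
exists v, u; split; first split.
- by move=> k; exact: w0.
- move=> a; pose e : {ffun J -> R^o} := [ffun c => (c == a)%:R].
  have eE c : e c = (c == a)%:R by rewrite ffunE.
  have := bE (e, 0, 0); have := w0 (inl (inl (inl a))).
  rewrite /b /flow /load /= !mulr0 !subr0.
  under eq_bigr do rewrite eE.
  rewrite sum_delta mulr1.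
  under eq_bigr do rewrite mulr0 subr0 mulr_sumr.
  rewrite (sum_fiber (@cls R S) (fun i c => v i * (service c * e c))) /=.
  under eq_bigr do rewrite eE mulrA.
  rewrite sum_delta mulr1.
  under eq_bigr do rewrite subr0 mulr_sumr.
  rewrite (sum_fiber (@srv R S) (fun k c => u k * e c)) /=.
  under eq_bigr do rewrite eE.
  by rewrite sum_delta mulr1 /u; lra.
- have := bE (0, 0, 1); rewrite /b /flow /load /=.
  have := w0 (inr false).
  rewrite big1 => [|a _]; last by rewrite ffunE mulr0.
  rewrite big1 => [|a _]; last first.
    by rewrite big1 => [|c _]; rewrite ?ffunE mulr0// subr0 mulr0.
  under eq_bigr => k _.
    rewrite big1 => [|c _]; last by rewrite ffunE.
    rewrite sub0r mulrN1; over.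
  by rewrite sumrN; lra.
- have := bE (0, 1, 0); rewrite /b /flow /load /=.
  have := w0 (inr true).
  rewrite big1 => [|a _]; last by rewrite ffunE mulr0.
  under eq_bigr => k _.
    rewrite big1 => [|c _]; last by rewrite ffunE mulr0.
    rewrite sub0r mulr1 mulrN mulrC; over.
  rewrite [\sum_(k < nserver S) _]big1 => [|k _]; last first.
    by rewrite big1 => [|c _]; rewrite ?ffunE// subr0 mulr0.
  by rewrite sumrN; lra.
Qed.

End LP.

Section Duality.
Context (R : realType) (S : parallel_server_system R).
Context (v : 'I_(nclass S) -> R) (u : 'I_(nserver S) -> R).

(** Summed against [x], the dual constraints give that the dual value is at most [\sum_k u k <= 1].
    Strong duality makes the dual value at least 1, so everything is an equality, and the
    nonnegative gaps of the individual activities vanish. *)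
Lemma complementary_slackness (x : activity S -> R) :
  heavy_traffic_allocation x -> dual_optimal v u ->
  [/\ \sum_k u k = 1, \sum_i arrival i * v i = 1 &
      forall a, basic x a -> service a * v (cls a) = u (srv a)].
Proof.
move=> [xopt load1] [[u0 vu u1] vmax].
have [[x0 _ flow _] _] := xopt.
have [v' [u' [dfv' v'1]]] := dual_value_ge xopt.
have v1 : 1 <= \sum_i arrival i * v i := le_trans v'1 (vmax _ _ dfv').
have vE : \sum_i arrival i * v i = \sum_a service a * v (cls a) * x a.
  rewrite (eq_bigr (fun i => \sum_(a | cls a == i) service a * v i * x a)).
    by rewrite (sum_fiber (@cls R S) (fun i a => service a * v i * x a)).
  move=> i _; rewrite -flow mulr_suml; apply: eq_bigr => a _; lra.
have uE : \sum_k u k = \sum_a u (srv a) * x a.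
  rewrite -(sum_fiber (@srv R S) (fun k a => u k * x a)).
  by apply: eq_bigr => k _; rewrite -mulr_sumr load1 mulr1.
have le_term a : service a * v (cls a) * x a <= u (srv a) * x a.
  by rewrite ler_wpM2r.
have vleu : \sum_i arrival i * v i <= \sum_k u k by rewrite vE uE ler_sum.
have su : \sum_k u k = 1 by lra.
have sv : \sum_i arrival i * v i = 1 by lra.
split=> // a xa.
have gap0 : \sum_a (u (srv a) * x a - service a * v (cls a) * x a) = 0.
  by rewrite sumrB -vE -uE su sv subrr.
have /eqP : u (srv a) * x a - service a * v (cls a) * x a = 0.
  by apply: (psumr_eq0P _ gap0) => // b _; rewrite subr_ge0.
by rewrite -mulrBl mulf_eq0 (gt_eqF xa) orbF subr_eq0 => /eqP ->.
Qed.

(** If [u k = 0], complementary slackness gives [v i = 0] for each class basic at [k], and then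
    [u = 0] at every server that communicates directly with [k]. Along paths this reaches all
    servers, against [\sum_k u k = 1]. Each link may use its own allocation. *)
Lemma dual_server_gt0 : relaxed_complete_resource_pooling S ->
  dual_optimal v u -> forall k, 0 < u k.
Proof.
move=> [[x hx] crp] dopt k; have [[u0 _ _] _] := dopt.
have [su _ _] := complementary_slackness hx dopt.
rewrite lt_neqAle u0 andbT eq_sym; apply/negP => /eqP uk.
suff u_eq0 k' : u k' = 0.
  by move: su; rewrite big1 // => /esym/eqP; rewrite oner_eq0.
have /connectP[p] := crp k k'.
elim: p k uk => [|k1 p IH] k uk /=; first by move=> _ ->.
case/andP=> /asboolP[y [hy [a [b [ab ak bk ya yb]]]]] kp; apply: IH kp.
have [_ _ cs] := complementary_slackness hy dopt.
have /eqP := cs a ya; rewrite ak uk mulf_eq0 gt_eqF ?service_gt0//= => /eqP va.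
by rewrite -bk -cs// -ab va mulr0.
Qed.

End Duality.

(** * Slack of the routing rule and its control of the scaled workloads *)

Section Slack.
Context (R : realType) (S : parallel_server_system R).
Implicit Types (z : state S) (x : activity S -> R).

(** The allocation ensures that every class has an activity, since an empty flow sum cannot equal a
    positive arrival rate; so [wwta] never returns [None]. *)
Lemma wwtaP x i z : heavy_traffic_allocation x ->
  exists a, [/\ wwta i z = Some a, cls a = i &
    forall b, cls b = i -> weighted_workload a z <= weighted_workload b z].
Proof.
move=> [[[_ _ flow _] _] _].
have [a0 a0i] : exists a0 : activity S, cls a0 == i.
  apply/existsP; apply: contraT; rewrite negb_exists => /forallP ni.
  have := arrival_gt0 i; rewrite -flow big_pred0 ?ltxx// => a.
  exact: negbTE.
have [a1 a1i a1min] := arg_minP (P := fun a => cls a == i)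
  (fun a => weighted_workload a z) a0i.
have a1in : a1 \in wwta_argmin i z.
  by rewrite inE a1i; apply/forallP => b; apply/implyP => /a1min.
have [a2 a2in a2min] := arg_minnP
  (P := fun a => a \in wwta_argmin i z) (fun a => srv a) a1in.
rewrite /wwta; case: pickP => [a /andP[+ _]|/(_ a2)]; last first.
  rewrite /= a2in/= => /negP; case; apply/forallP => b; apply/implyP.
  exact: a2min.
rewrite inE => /andP[/eqP ai /forallP amin]; exists a; split => // b /eqP bi.
by have := amin b; rewrite bi.
Qed.

Definition routed_workload i z : R :=
  if wwta i z is Some a then weighted_workload a z else 0.

Definition slack z : R :=
  \sum_k workload k z - \sum_i arrival i * routed_workload i z.

(** The total load of [x] is 1 at each server, which rewrites the sum of the workloads over
    activities, and its flow for class [i] is [arrival i], which does the same for the routed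
    workloads. *)
Lemma slackE x z : heavy_traffic_allocation x -> slack z =
  \sum_a service a * x a *
    (weighted_workload a z - routed_workload (cls a) z).
Proof.
move=> [[[_ _ flow _] _] load1].
under eq_bigr do rewrite mulrBr.
rewrite sumrB; congr (_ - _).
  rewrite [RHS](eq_bigr (fun a => x a * workload (srv a) z)); last first.
    move=> a _; rewrite /weighted_workload /mean_service; field.
    by rewrite gt_eqF ?service_gt0.
  rewrite -(sum_fiber (@srv R S) (fun k a => x a * workload k z)).
  by apply: eq_bigr => k _; rewrite -mulr_suml load1 mul1r.
rewrite -(sum_fiber (@cls R S) (fun i a => service a * x a * routed_workload i z)).
by apply: eq_bigr => i _; rewrite -mulr_suml flow.
Qed.

Lemma routed_workload_le x a z : heavy_traffic_allocation x ->
  routed_workload (cls a) z <= weighted_workload a z.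
Proof.
move=> hx; rewrite /routed_workload.
by have [b [-> _]] := wwtaP (cls a) z hx; apply.
Qed.

Lemma slack_ge x a z : heavy_traffic_allocation x ->
  service a * x a * (weighted_workload a z - routed_workload (cls a) z) <=
    slack z.
Proof.
move=> hx; have [[[x0 _ _ _] _] _] := hx.
rewrite (slackE z hx) (bigD1 a)//= lerDl sumr_ge0// => b _.
by rewrite mulr_ge0 ?subr_ge0 ?(routed_workload_le _ _ hx)// mulr_ge0// ltW// service_gt0.
Qed.

Lemma slack_ge0 x z : heavy_traffic_allocation x -> 0 <= slack z.
Proof.
move=> hx; have [[[x0 _ _ _] _] _] := hx.
rewrite (slackE z hx) sumr_ge0// => b _.
by rewrite mulr_ge0 ?subr_ge0 ?(routed_workload_le _ _ hx)// mulr_ge0// ltW// service_gt0.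
Qed.

(** The two activities share a class. By [slack_ge] each of their weighted workloads exceeds the
    routed workload of that class by at most a multiple of the slack, and complementary slackness
    identifies these weighted workloads with [v i] times the scaled ones. *)
Lemma communicate_directly_slack v u k k' : relaxed_complete_resource_pooling S ->
  dual_optimal v u -> communicate_directly k k' ->
  exists2 C : R, 0 <= C &
    forall z, `|scaled_workload u z k - scaled_workload u z k'| <= C * slack z.
Proof.
move=> crp dopt [x [hx [a [b [ab <- <- xa xb]]]]].
have u_gt0 := dual_server_gt0 crp dopt.
have [_ _ cs] := complementary_slackness hx dopt.
have v_gt0 : 0 < v (cls a).
  by rewrite -(pmulr_rgt0 _ (service_gt0 a)) cs// u_gt0.
pose ca := (service a * x a)^-1; pose cb := (service b * x b)^-1.
have ca0 : 0 < ca by rewrite invr_gt0 mulr_gt0// service_gt0.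
have cb0 : 0 < cb by rewrite invr_gt0 mulr_gt0// service_gt0.
exists ((ca + cb) / v (cls a)).
  by rewrite divr_ge0 ?addr_ge0// ltW.
move=> z; pose m := routed_workload (cls a) z.
(* [m_a u_k = v_i] for basic [a], so its routing weight is [v_i T_k] *)
have wE c : basic x c -> cls c = cls a ->
    weighted_workload c z = v (cls a) * scaled_workload u z (srv c).
  move=> xc ca_; rewrite /weighted_workload /scaled_workload -cs// -ca_.
  rewrite /mean_service invfM; field.
  by rewrite !gt_eqF ?service_gt0//= ca_.
have key c : basic x c -> cls c = cls a ->
   0 <= weighted_workload c z - m <= (service c * x c)^-1 * slack z.
  move=> xc ca_; rewrite /m -ca_ subr_ge0 (routed_workload_le _ _ hx)/=.
  by rewrite ler_pdivlMl ?mulr_gt0 ?service_gt0// slack_ge.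
have /andP[a1 a2] := key a xa erefl.
have /andP[b1 b2] := key b xb (esym ab).
have sl := slack_ge0 z hx.
rewrite mulrAC ler_pdivlMr// -[X in _ * X]gtr0_norm// -normrM mulrBl.
rewrite ![_ * v _]mulrC -(wE a)// -(wE b)//.
rewrite -/ca in a2; rewrite -/cb in b2; rewrite ler_norml mulrDl.
have : 0 <= ca * slack z by rewrite mulr_ge0// ltW.
have : 0 <= cb * slack z by rewrite mulr_ge0// ltW.
by move=> ? ?; apply/andP; split; lra.
Qed.

Lemma scaled_workload_dist_slack v u : relaxed_complete_resource_pooling S ->
  dual_optimal v u ->
  exists2 C : R, 0 < C & forall k k' z,
    `|scaled_workload u z k - scaled_workload u z k'| <= C * slack z.
Proof.
move=> crp dopt; have [[x0 hx0] comm] := crp.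
have pairwise k k' : exists C : R, 0 <= C /\
    forall z, `|scaled_workload u z k - scaled_workload u z k'| <= C * slack z.
  have /connectP[p] := comm k k'.
  elim: p k => [|k1 p IH] k /=.
    by move=> _ ->; exists 0; split => // z; rewrite subrr normr0 mul0r.
  case/andP=> /asboolP kk1 /IH/[apply] -[C [C0 HC]].
  have [C' C'0 HC'] := communicate_directly_slack crp dopt kk1.
  exists (C' + C); split; first exact: addr_ge0.
  by move=> z; rewrite mulrDl (le_trans (ler_distD (scaled_workload u z k1) _ _)) ?lerD.
have [C HC] := choice (fun kk : 'I_(nserver S) * 'I_(nserver S) => pairwise kk.1 kk.2).
(* One constant for all the finitely many pairs; the 1 makes it positive. *)
exists (1 + \sum_kk C kk).
  by rewrite ltr_wpDr// sumr_ge0// => kk _; case: (HC kk).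
move=> k k' z; have [_ /(_ z) /le_trans] := HC (k, k'); apply.
rewrite ler_wpM2r ?(slack_ge0 _ hx0)// (bigD1 (k, k'))//= addrCA lerDl.
by rewrite addr_ge0// sumr_ge0// => kk _; case: (HC kk).
Qed.

End Slack.

(** * Drift of the distance to the collapse direction *)

(** Finitely many jump types, each with a state-dependent rate and a jump map. [wwta_generator] is
    brought to this form so that the moment bound can be proved for general jump chains. *)
Definition jump_generator (R : realType) (T : Type) (E : finType)
    (c : E -> T -> R) (tau : E -> T -> T) (f : T -> R) (x : T) : R :=
  \sum_e c e x * (f (tau e x) - f x).

Section Potential.
Context (R : realType) (S : parallel_server_system R).
Context (P : scheduling_policy S) (v : 'I_(nclass S) -> R).
Context (u : 'I_(nserver S) -> R).
Context (hx : exists x : activity S -> R, heavy_traffic_allocation x).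
Context (dopt : dual_optimal v u) (u_gt0 : forall k, 0 < u k).
Implicit Types (z : state S) (e : bool * activity S).

Let J := {a : 'I_(nclass S) * 'I_(nserver S) | a \in activities S}.

Definition jump (e : bool * J) z : state S :=
  if e.1 then incr z e.2 else decr z e.2.

Definition jump_rate (r : R) (e : bool * J) z : R :=
  if e.1 then arrival_r r (cls e.2) * (Some e.2 == wwta (cls e.2) z)%:R
  else service e.2 * effort P z e.2.

Lemma wwta_generatorE r f z :
  wwta_generator P r f z = jump_generator (jump_rate r) jump f z.
Proof.
pose F b a := jump_rate r (b, a) z * (f (jump (b, a) z) - f z).
rewrite /jump_generator (eq_bigr (fun p => F p.1 p.2)); last by case.
rewrite -(pair_bigA _ F) big_bool /F /jump_rate /jump /wwta_generator /=.
congr (_ + _); last first.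
  by rewrite (sum_fiber (@srv R S)
    (fun _ a => service a * effort P z a * (f (decr z a) - f z))).
under eq_bigr do rewrite mulr_sumr.
rewrite (sum_fiber (@cls R S) (fun i a =>
  arrival_r r i * ((f (incr z a) - f z) * (Some a == wwta i z)%:R))).
by apply: eq_bigr => a _; rewrite [_ * _%:R in LHS]mulrC mulrA.
Qed.

Lemma jump_rate_ge0 r e z : 0 < r < 1 -> 0 <= jump_rate r e z.
Proof.
move=> r01; rewrite /jump_rate; case: ifP => _; rewrite mulr_ge0//.
- by rewrite mulr_ge0// ?(ltW (arrival_gt0 _))//; lra.
- exact/ltW/service_gt0.
- by have /andP[] := effort_itv P z e.2.
Qed.

Definition total_rate : R := \sum_(a : J) (arrival (cls a) + service a).

Lemma sum_jump_rate_le r z : 0 < r < 1 ->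
  \sum_e jump_rate r e z <= total_rate.
Proof.
move=> r01; pose F b a := jump_rate r (b, a) z.
rewrite (eq_bigr (fun p => F p.1 p.2)); last by case.
rewrite -(pair_bigA _ F) big_bool -big_split ler_sum// => a _.
rewrite /F /jump_rate /= lerD//.
- have la := arrival_gt0 (cls a); rewrite /arrival_r.
  by case: eqP => _; rewrite ?mulr1 ?mulr0; nra.
- rewrite ler_piMr ?(ltW (service_gt0 _))//.
  by have /andP[] := effort_itv P z a.
Qed.

Definition sq_norm_u : R := \sum_k u k ^+ 2.

(** The coefficient of the orthogonal projection of [w] onto the line spanned by [u]; [dev] is the
    remainder and [sq_dev] its squared length. *)
Definition center (w : 'I_(nserver S) -> R) : R :=
  (\sum_k u k * w k) / sq_norm_u.

Definition dev (w : 'I_(nserver S) -> R) k : R := w k - u k * center w.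

Definition sq_dev (w : 'I_(nserver S) -> R) : R := \sum_k dev w k ^+ 2.

(** The added 1 keeps the root at least 1, so that differences of squares can be divided by sums of
    potentials. *)
Definition potential z : R := Num.sqrt (1 + sq_dev (fun k => workload k z)).

Lemma sum_u : \sum_k u k = 1.
Proof. by case: hx => x hx'; have [] := complementary_slackness hx' dopt. Qed.

Lemma u_le1 k : u k <= 1.
Proof.
by rewrite -sum_u (bigD1 k)//= lerDl sumr_ge0// => j _; exact: ltW.
Qed.

Lemma sq_norm_u_gt0 : 0 < sq_norm_u.
Proof.
rewrite lt_neqAle sumr_ge0 ?andbT; last by move=> k _; rewrite sqr_ge0.
rewrite eq_sym; apply/negP => /eqP q0.
have uk0 k : u k = 0.
  apply/eqP; rewrite -sqrf_eq0; apply/eqP.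
  by apply: (psumr_eq0P _ q0) => // j _; rewrite sqr_ge0.
by have := sum_u; rewrite big1// => /esym/eqP; rewrite oner_eq0.
Qed.

Lemma sum_u_dev w : \sum_k u k * dev w k = 0.
Proof.
under eq_bigr do rewrite /dev mulrBr mulrA -expr2.
rewrite sumrB -mulr_suml -/sq_norm_u /center mulrC mulfVK ?subrr//.
by rewrite gt_eqF ?sq_norm_u_gt0.
Qed.

Lemma sum_dev w : \sum_k dev w k = \sum_k w k - center w.
Proof. by rewrite sumrB -mulr_suml sum_u mul1r. Qed.

(** Since [dev w] is orthogonal to [u], its inner product with the projected unit vector of [j] is
    [dev w j]; the squared length of that projected vector is the last factor. *)
Lemma sq_dev_shift w w' j h : (forall k, w' k = w k + h * (k == j)%:R) ->
  sq_dev w' = sq_dev w + 2 * h * dev w j + h ^+ 2 * (1 - u j ^+ 2 / sq_norm_u).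
Proof.
move=> w'E; have U0 := sq_norm_u_gt0.
have cE : center w' = center w + h * u j / sq_norm_u.
  rewrite /center -mulrDl; congr (_ / _).
  under eq_bigr do rewrite w'E mulrDr mulrA.
  by rewrite big_split /= sum_delta mulr1; lra.
have dE k : dev w' k = dev w k + h * (k == j)%:R - h * u j / sq_norm_u * u k.
  by rewrite /dev cE w'E; lra.
rewrite /sq_dev.
have -> : \sum_k dev w' k ^+ 2 =
  \sum_k dev w k ^+ 2 + \sum_k (2 * h * dev w k) * (k == j)%:R
  + \sum_k (h ^+ 2 - 2 * h ^+ 2 * u j / sq_norm_u * u k) * (k == j)%:R
  - (2 * h * u j / sq_norm_u) * (\sum_k u k * dev w k)
  + (h * u j / sq_norm_u) ^+ 2 * sq_norm_u.
  rewrite /sq_norm_u !mulr_sumr -/sq_norm_u -!big_split -sumrB -!big_split /=.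
  apply: eq_bigr => k _; rewrite dE.
  by case: eqP => _; rewrite ?mulr1 ?mulr0; ring.
rewrite !sum_delta sum_u_dev !mulr1 mulr0 subr0.
by field; rewrite gt_eqF.
Qed.

Lemma sq_dev_ge0 w : 0 <= sq_dev w.
Proof. by rewrite sumr_ge0// => k _; rewrite sqr_ge0. Qed.

Lemma sqr_potential z : potential z ^+ 2 = 1 + sq_dev (fun k => workload k z).
Proof. by rewrite sqr_sqrtr// addr_ge0// sq_dev_ge0. Qed.

Lemma potential_ge1 z : 1 <= potential z.
Proof.
rewrite -[X in X <= _]sqrtr1 ler_sqrt ?lerDl ?sq_dev_ge0//.
by rewrite addr_ge0 ?sq_dev_ge0.
Qed.

Lemma dev_le_potential z k : `|dev (fun k => workload k z) k| <= potential z.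
Proof.
rewrite -(@ler_pXn2r _ 2)// ?nnegrE//; last exact: le_trans (potential_ge1 z).
rewrite real_normK ?num_real// sqr_potential /sq_dev (bigD1 k)//= addrCA lerDl.
by rewrite addr_ge0// sumr_ge0// => j _; rewrite sqr_ge0.
Qed.

(** The empty-buffer case matches the truncation in [decr], so [workload_jump] holds in every
    state. *)
Definition jump_size e z : R :=
  if e.1 then mean_service e.2
  else if z e.2 == 0%N then 0 else - mean_service e.2.

Lemma mean_service_gt0 (a : activity S) : 0 < mean_service a.
Proof. by rewrite invr_gt0 service_gt0. Qed.

Lemma workload_jump e z k :
  workload k (jump e z) = workload k z + jump_size e z * (k == srv e.2)%:R.
Proof.
case: e => b a; rewrite /workload /jump /jump_size /=.
have H (h : R) (z' : state S) :
    (forall c, (z' c)%:R = (z c)%:R + h * (c == a)%:R :> R) ->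
    \sum_(c | srv c == k) mean_service c * (z' c)%:R =
    \sum_(c | srv c == k) mean_service c * (z c)%:R +
      mean_service a * h * (k == srv a)%:R.
  move=> z'E; under eq_bigr do rewrite z'E mulrDr mulrA.
  by rewrite big_split /= sum_delta eq_sym.
case: b => /=.
  rewrite (H 1) ?mulr1// => c.
  by rewrite /incr ffunE natrD mul1r.
case: ifP => [/eqP za|/negbT za].
  rewrite (H 0) ?mulr0// => c; rewrite /decr ffunE mul0r addr0.
  by case: eqP => [->|_]; rewrite ?za ?subn0.
rewrite (H (-1)) ?mulrN1// => c; rewrite /decr ffunE natrB ?mulN1r//.
by case: eqP => [->|//]; rewrite lt0n.
Qed.

Lemma jump_size_le e z : `|jump_size e z| <= mean_service e.2.
Proof.
have m0 := mean_service_gt0 e.2; rewrite /jump_size.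
by do 2?case: ifP => _; rewrite ?normr0 ?normrN ?gtr0_norm// ltW.
Qed.

Lemma sq_dev_jump e z (h := jump_size e z) (d := dev (fun k => workload k z) (srv e.2)) :
  2 * h * d <= sq_dev (fun k => workload k (jump e z)) - sq_dev (fun k => workload k z) <=
  2 * h * d + h ^+ 2.
Proof.
rewrite (sq_dev_shift (workload_jump e z)) -/h -/d.
have c0 : 0 <= u (srv e.2) ^+ 2 / sq_norm_u <= 1.
  have U0 := sq_norm_u_gt0.
  rewrite divr_ge0 ?sqr_ge0 ?(ltW U0)//= ler_pdivrMr// mul1r /sq_norm_u.
  rewrite (bigD1 (srv e.2))//= lerDl sumr_ge0// => k _; exact: sqr_ge0.
have := sqr_ge0 h; nra.
Qed.

Definition jump_bound : R :=
  \sum_(a : J) (2 * mean_service a + mean_service a ^+ 2).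

(** The difference of the squared potentials is at most [2 * mean_service * potential + mean_service
    ^ 2] in absolute value; dividing by the sum of the two potentials, both at least 1, leaves a
    constant. *)
Lemma potential_jump e z : `|potential (jump e z) - potential z| <= jump_bound.
Proof.
have y1 := potential_ge1 z; have y'1 := potential_ge1 (jump e z).
have K : 2 * mean_service e.2 + mean_service e.2 ^+ 2 <= jump_bound.
  rewrite /jump_bound (bigD1 e.2)//= lerDl sumr_ge0// => a _.
  by rewrite addr_ge0 ?sqr_ge0// mulr_ge0// ltW// mean_service_gt0.
have m0 := mean_service_gt0 e.2.
have := sqr_potential z; have := sqr_potential (jump e z).
have := sq_dev_jump e z; have := dev_le_potential z (srv e.2).
have := jump_size_le e z; move: (jump_size e z) (dev _ _) => h d.
set q' := sq_dev _; set q := sq_dev _ => hm dy qq y'E yE.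
have h2 : h ^+ 2 <= mean_service e.2 ^+ 2.
  by rewrite -[h ^+ 2]real_normK ?num_real// ler_pXn2r ?nnegrE// ltW.
have hd : `|h * d| <= mean_service e.2 * potential z.
  by rewrite normrM ler_pM.
rewrite -(ler_pM2r (x := potential (jump e z) + potential z)); last by lra.
rewrite -[X in _ * X]gtr0_norm -?normrM; last by lra.
have -> : (potential (jump e z) - potential z) *
    (potential (jump e z) + potential z) = q' - q.
  transitivity (potential (jump e z) ^+ 2 - potential z ^+ 2); first by ring.
  by rewrite yE y'E; lra.
move: hd; rewrite !ler_norml => /andP[hd1 hd2].
have m2y : mean_service e.2 ^+ 2 <= mean_service e.2 ^+ 2 * potential z.
  by rewrite ler_peMr// sqr_ge0.
have : (2 * mean_service e.2 + mean_service e.2 ^+ 2) * potential z <=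
    jump_bound * (potential (jump e z) + potential z).
  by rewrite ler_pM ?addr_ge0 ?sqr_ge0 ?mulr_ge0 ?(ltW m0)//; lra.
by move=> le_jb; apply/andP; split; move/andP: qq => [? ?]; lra.
Qed.

Definition drift_const : R := total_rate * \sum_(a : J) mean_service a ^+ 2.

Lemma sq_dev_drift_le r z : 0 < r < 1 ->
  jump_generator (jump_rate r) jump (fun z' => sq_dev (fun k => workload k z')) z <=
  2 * (\sum_e jump_rate r e z * (jump_size e z * dev (fun k => workload k z) (srv e.2)))
  + drift_const.
Proof.
move=> r01; rewrite /drift_const /jump_generator.
apply: (@le_trans _ _ (2 * (\sum_e jump_rate r e z *
    (jump_size e z * dev (fun k => workload k z) (srv e.2)))
  + (\sum_e jump_rate r e z) * \sum_(a : J) mean_service a ^+ 2)); last first.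
  by rewrite lerD2l ler_wpM2r ?sum_jump_rate_le// sumr_ge0// => a _; exact: sqr_ge0.
rewrite mulr_sumr mulr_suml -big_split ler_sum// => e _ /=.
have := sq_dev_jump e z; move: (dev _ _) => d /andP[_ Hle].
have c0 := jump_rate_ge0 e z r01.
have : jump_size e z ^+ 2 <= \sum_(a : J) mean_service a ^+ 2.
  apply: (@le_trans _ _ (mean_service e.2 ^+ 2)).
    rewrite -[X in X <= _]real_normK ?num_real// ler_pXn2r ?nnegrE ?jump_size_le//.
    exact/ltW/mean_service_gt0.
  by rewrite (bigD1 e.2)//= lerDl sumr_ge0// => a _; exact: sqr_ge0.
move: Hle; set D := sq_dev _ - sq_dev _.
by move=> H1 H2; have := ler_wpM2l c0 H1; have := ler_wpM2l c0 H2; lra.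
Qed.

Lemma workload_ge0 k z : 0 <= workload k z.
Proof.
by rewrite sumr_ge0// => a _; rewrite mulr_ge0// ltW// mean_service_gt0.
Qed.

Lemma center_ge0 z : 0 <= center (fun k => workload k z).
Proof.
rewrite divr_ge0 ?(ltW sq_norm_u_gt0)// sumr_ge0// => k _.
by rewrite mulr_ge0 ?workload_ge0// ltW.
Qed.

(** Arrivals contribute at most [1 - r] times the routed workloads minus [center], and departures at
    most [- \sum_k dev w k]. As [\sum_k dev w k] is the total workload minus [center], the two
    combine to the bound. *)
Lemma first_order_drift_le r z (w := fun k => workload k z) : 0 < r < 1 ->
  \sum_e jump_rate r e z * (jump_size e z * dev w (srv e.2)) <=
  - r * (\sum_k dev w k) - (1 - r) * slack z.
Proof.
move=> r01; have s0 := center_ge0 z; have [x hx'] := hx.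
have [su sv _] := complementary_slackness hx' dopt.
pose F b a := jump_rate r (b, a) z * (jump_size (b, a) z * dev w (srv a)).
rewrite (eq_bigr (fun p => F p.1 p.2)); last by case.
rewrite -(pair_bigA _ F) big_bool /F /jump_rate /jump_size /=.
(* Only the routed activity of each class contributes. Its [mean_service a * u (srv a)] is at least
   [v i] and [center] is nonnegative, so the projection terms are bounded through
   [\sum_i arrival i * v i = 1]. *)
have A : \sum_(a : J) arrival_r r (cls a) * (Some a == wwta (cls a) z)%:R *
    (mean_service a * dev w (srv a)) <=
    (1 - r) * (\sum_i arrival i * routed_workload i z - center w).
  pose H (i : 'I_(nclass S)) (a : J) := arrival_r r i * (Some a == wwta i z)%:R *
    (mean_service a * dev w (srv a)).
  rewrite -(sum_fiber (@cls R S) H).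
  have -> : center w = \sum_i arrival i * v i * center w.
    by rewrite -mulr_suml sv mul1r.
  rewrite -sumrB mulr_sumr ler_sum// => i _.
  have [a [La ai amin]] := wwtaP i z hx'.
  rewrite (bigD1 a) ?ai//= big1 => [|b /andP[_ ba]]; last first.
    rewrite /H La; case: eqP => [[/eqP]|_]; last by rewrite mulr0 mul0r.
    by rewrite (negPf ba).
  rewrite addr0 /H La eqxx mulr1 /arrival_r /routed_workload La /weighted_workload /dev.
  have [[_ vu _] _] := dopt.
  have mu : v i <= mean_service a * u (srv a).
    by rewrite -ai /mean_service mulrC ler_pdivlMr ?service_gt0// mulrC vu.
  have l0 : 0 <= arrival i * (1 - r).
    by rewrite mulr_ge0 ?(ltW (arrival_gt0 _))//; lra.
  have H1 : v i * center w <= mean_service a * u (srv a) * center w.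
    exact: ler_wpM2r.
  have := ler_wpM2l l0 H1; rewrite /w /=; lra.
(* A busy server spends effort exactly 1. An empty one spends none, and there [dev] is nonpositive
   because the workload is 0 and [center] is nonnegative. *)
have B : \sum_k dev w k <= \sum_(a : J) effort P z a * dev w (srv a).
  rewrite -(sum_fiber (@srv R S) (fun k a => effort P z a * dev w k)).
  rewrite ler_sum// => k _; rewrite -mulr_suml.
  have [z0|] := posnP (\sum_(a | srv a == k) z a)%N; last first.
    by move=> /effort_nonidling ->; rewrite mul1r.
  have za a : srv a = k -> z a = 0%N.
    move=> ak; apply/eqP; rewrite -leqn0 -z0 (bigD1 a) ?ak//=.
    exact: leq_addr.
  rewrite big1 ?mul0r => [|a /eqP ak]; last by rewrite effort_empty// za.
  rewrite /dev /w /workload big1 => [|a /eqP ak]; last by rewrite za// mulr0.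
  by rewrite sub0r oppr_le0 mulr_ge0// ltW.
have C : \sum_(a : J) service a * effort P z a *
    ((if z a == 0%N then 0 else - mean_service a) * dev w (srv a)) =
    - \sum_(a : J) effort P z a * dev w (srv a).
  rewrite -sumrN; apply: eq_bigr => a _; case: eqP => [za|_].
    by rewrite effort_empty// mulr0 !mul0r oppr0.
  by rewrite /mean_service; field; rewrite gt_eqF ?service_gt0.
rewrite C; move: A B; rewrite /slack sum_dev -/w.
set X := \sum_k _; lra.
Qed.

Section Drift.
Context (C : R) (C_gt0 : 0 < C).
Context (dist_slack : forall k k' z,
  `|scaled_workload u z k - scaled_workload u z k'| <= C * slack z).

(** Divided by [u k], the deviation is the average over [j] of the differences of scaled workloads
    at [k] and [j], with weights [u j ^+ 2 / sq_norm_u]. *)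
Lemma dev_le_slack z k : `|dev (fun k => workload k z) k| <= u k * (C * slack z).
Proof.
have U0 := sq_norm_u_gt0.
have WE j : workload j z = u j * scaled_workload u z j.
  by rewrite /scaled_workload mulrC divfK// gt_eqF.
have -> : dev (fun k => workload k z) k = u k / sq_norm_u * \sum_j u j ^+ 2 *
    (scaled_workload u z k - scaled_workload u z j).
  under eq_bigr do rewrite mulrBr.
  rewrite sumrB -mulr_suml -/sq_norm_u /dev /center WE.
  rewrite [in LHS](eq_bigr (fun j => u j ^+ 2 * scaled_workload u z j)).
    by field; rewrite gt_eqF.
  by move=> j _; rewrite WE; ring.
rewrite normrM gtr0_norm ?divr_gt0// -mulrA ler_pM2l//.
rewrite ler_pdivrMl// /sq_norm_u mulr_suml.
apply: (le_trans (ler_norm_sum _ _ _)); apply: ler_sum => j _.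
by rewrite normrM ger0_norm ?sqr_ge0// ler_wpM2l ?sqr_ge0.
Qed.

Lemma potential_le_slack z : potential z <= 1 + C * slack z.
Proof.
have [x hx'] := hx; have s0 := slack_ge0 z hx'.
have Cs : 0 <= C * slack z by rewrite mulr_ge0// ltW.
rewrite -(@ler_pXn2r _ 2)// ?nnegrE//; last by lra.
  rewrite sqr_potential.
  suff : sq_dev (fun k => workload k z) <= (C * slack z) ^+ 2 by lra.
  (* Since [u k <= 1], each [u k ^+ 2] may be replaced by [u k], and these sum to 1. *)
  apply: (@le_trans _ _ (\sum_k u k * (C * slack z) ^+ 2)); last first.
    by rewrite -mulr_suml sum_u mul1r.
  apply: ler_sum => k _; rewrite -real_normK ?num_real//.
  apply: (@le_trans _ _ ((u k * (C * slack z)) ^+ 2)).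
    by rewrite ler_pXn2r ?nnegrE ?dev_le_slack// mulr_ge0// ltW.
  rewrite exprMn ler_wpM2r ?sqr_ge0// expr2 ler_piMr ?u_le1 ?(ltW (u_gt0 k))//.
exact: le_trans (potential_ge1 z).
Qed.

(** The drift of [sq_dev] is at most [- 2 * slack + 2 * r * (1 + C) * slack + drift_const], and the
    bound on [r] lets half of the negative term survive. Passing to the root divides by twice the
    potential, which the slack dominates. *)
Lemma potential_drift r z : 0 < r < (2 * (1 + C))^-1 ->
  2 + 2 * C * drift_const <= potential z ->
  jump_generator (jump_rate r) jump potential z <= - (4 * C)^-1.
Proof.
move=> /andP[r0 rr0] yB; have C0 := C_gt0.
have C1 : 0 < 2 * (1 + C) by lra.
have rC : r * (2 * (1 + C)) < 1 by rewrite -ltr_pdivlMr// mul1r.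
have r01 : 0 < r < 1.
  rewrite r0/= (lt_trans rr0)// invf_lt1//; lra.
have [x hx'] := hx; have s0 := slack_ge0 z hx'.
have y1 := potential_ge1 z.
(* Concavity of the root, in the form [2 * y * (y' - y) <= y' ^+ 2 - y ^+ 2]. *)
have step e : 2 * potential z * (jump_rate r e z * (potential (jump e z) - potential z))
  <= jump_rate r e z * (sq_dev (fun k => workload k (jump e z)) -
    sq_dev (fun k => workload k z)).
  rewrite mulrCA ler_wpM2l ?jump_rate_ge0//.
  have := sqr_potential z; have := sqr_potential (jump e z).
  have := sqr_ge0 (potential (jump e z) - potential z); nra.
have GG : 2 * potential z * jump_generator (jump_rate r) jump potential z <=
  jump_generator (jump_rate r) jump (fun z' => sq_dev (fun k => workload k z')) z.
  by rewrite mulr_sumr ler_sum.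
have D1 := sq_dev_drift_le z r01; have D2 := first_order_drift_le z r01.
have D3 : `|\sum_k dev (fun k => workload k z) k| <= C * slack z.
  apply: (le_trans (ler_norm_sum _ _ _)).
  rewrite -[leRHS]mul1r -sum_u mulr_suml ler_sum// => k _; exact: dev_le_slack.
have D4 := potential_le_slack z.
move: D3; rewrite ler_norml => /andP[D3 _].
have D5 : - r * (\sum_k dev (fun k => workload k z) k) <= r * (C * slack z).
  by rewrite mulNr -mulrN ler_wpM2l ?(ltW r0)//; lra.
have D6 : 2 * (r * (1 + C) * slack z) <= slack z.
  by rewrite mulrA -[leRHS]mul1r ler_wpM2r//; lra.
have Gq : jump_generator (jump_rate r) jump (fun z' => sq_dev (fun k => workload k z')) z
  <= - slack z + drift_const by lra.
(* As [C * slack z >= potential z - 1], the right side is at most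
   [- potential z + 1 + C * drift_const], hence at most [- potential z / 2] by the threshold on the
   potential. *)
have : C * (2 * potential z * jump_generator (jump_rate r) jump potential z) <=
  C * (- slack z + drift_const).
  by rewrite ler_pM2l// (le_trans GG Gq).
move=> Gy; rewrite -[X in - X]mul1r -mulNr ler_pdivlMr; last by lra.
set g := jump_generator _ _ _ _ in Gy *.
have : potential z * (g * (4 * C)) <= potential z * -1 by lra.
by rewrite ler_pM2l//; lra.
Qed.

(** The triangle inequality through [center], from which [scaled_workload u z j] differs by [dev] at
    [j] divided by [u j]. *)
Lemma dist_le_potential z k k' :
  `|scaled_workload u z k - scaled_workload u z k'| <=
    (1 + 2 * \sum_j (u j)^-1) * potential z.
Proof.
have y1 := potential_ge1 z.
have TE j : scaled_workload u z j - center (fun k => workload k z) =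
    dev (fun k => workload k z) j * (u j)^-1.
  by rewrite /scaled_workload /dev; field; rewrite gt_eqF.
have le j : `|scaled_workload u z j - center (fun k => workload k z)| <=
    (\sum_j (u j)^-1) * potential z.
  rewrite TE normrM [`|_^-1|]gtr0_norm ?invr_gt0// mulrC.
  rewrite ler_pM ?invr_ge0 ?dev_le_potential//; first exact/ltW.
  by rewrite (bigD1 j)//= lerDl sumr_ge0// => i _; rewrite invr_ge0 ltW.
have l1 := le k; have := le k'; rewrite distrC => l2.
apply: (le_trans (ler_distD (center (fun k => workload k z)) _ _)); lra.
Qed.

End Drift.
End Potential.

(** * The basic adjoint relation *)

Lemma bernoulli_inequality (R : realFieldType) (a : R) n :
  0 <= a <= 1 -> 1 - n%:R * a <= (1 - a) ^+ n.
Proof.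
move=> a01; elim: n => [|n IH]; first by rewrite expr0; lra.
rewrite exprS -natr1; apply: (@le_trans _ _ ((1 - a) * (1 - n%:R * a))).
  have : 0 <= n%:R * a ^+ 2 by rewrite mulr_ge0// sqr_ge0.
  by lra.
by rewrite ler_wpM2l//; lra.
Qed.

Section BasicAdjointRelation.
Import numFieldNormedType.Exports.
Local Open Scope classical_set_scope.
Context (d : measure_display) (T : measurableType d) (R : realType).
Context (discreteT : forall A : set T, measurable A).

Lemma discrete_measurable_fun d' (U : sigmaRingType d') (D : set T)
  (f : T -> U) : measurable_fun D f.
Proof. by move=> _ Y _; exact: discreteT. Qed.

Lemma bounded_integrable (mu : probability T R) (f : T -> R) (M : R) :
  (forall x, `|f x| <= M) -> mu.-integrable setT (EFin \o f).
Proof.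
move=> fM; apply: measurable_bounded_integrable => //.
- by rewrite (le_lt_trans (probability_le1 mu measurableT))// ltry.
- exists M; split; first exact: num_real.
  by move=> B MB x _; exact: le_trans (fM x) (ltW MB).
Qed.

Lemma Rintegral_indic (mu : probability T R) (A : set T) :
  \int[mu]_x \1_A x = fine (mu A).
Proof. by rewrite /Rintegral integral_indic// setIT. Qed.

Lemma Rintegral_cst_probability (mu : probability T R) (r : R) :
  \int[mu]_x r = r.
Proof.
by rewrite Rintegral_cst// [X in fine X](probability_setT mu) mulr1.
Qed.

Lemma integral_EFin_Rintegral (mu : probability T R) (f : T -> R) (M : R) :
  (forall x, `|f x| <= M) -> (\int[mu]_x (f x)%:E)%E = (\int[mu]_x f x)%:E.
Proof.
by move=> fM; rewrite fineK// integrable_fin_num//; exact: bounded_integrable fM.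
Qed.

Context (p : R -> T -> probability T R) (G : (T -> R) -> T -> R).
Context (msg : markov_semigroup p) (gen : has_generator G p).

(** The probability of being at [x] at time [t], whether or not the process left in between. *)
Definition stay_prob (t : R) (x : T) : R := fine (p t x [set x]).

Lemma stay_probE t x : p t x [set x] = (stay_prob t x)%:E.
Proof. by rewrite fineK// fin_num_measure. Qed.

Lemma stay_prob_ge0 t x : 0 <= stay_prob t x.
Proof. exact: fine_ge0. Qed.

Lemma stay_prob_le1 t x : stay_prob t x <= 1.
Proof. by rewrite -lee_fin -stay_probE probability_le1. Qed.

(** The semigroup identity, keeping only the paths that are at [x] at time [s]. *)
Lemma stay_probD s t x : 0 <= s -> 0 <= t ->
  stay_prob s x * stay_prob t x <= stay_prob (s + t) x.
Proof.
move=> s0 t0; rewrite -lee_fin -stay_probE msg.2//.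
have -> : (stay_prob s x * stay_prob t x)%:E =
    (\int[p s x]_y (stay_prob t x * \1_[set x] y)%:E)%E.
  under eq_integral do rewrite EFinM.
  rewrite ge0_integralZl_EFin ?stay_prob_ge0//.
  rewrite integral_indic// setIT [X in (_ * X)%E](stay_probE s x).
  by rewrite -EFinM mulrC.
apply: ge0_le_integral => //; try exact: discrete_measurable_fun.
  by move=> y _; rewrite lee_fin mulr_ge0 ?stay_prob_ge0.
move=> y _; rewrite indicE; case: (boolP (y \in _)) => [|_].
  by rewrite inE => /= ->; rewrite mulr1 stay_probE.
by rewrite mulr0.
Qed.

Lemma stay_probMn t x n : 0 <= t -> stay_prob t x ^+ n <= stay_prob (n%:R * t) x.
Proof.
move=> t0; elim: n => [|n IH].
  rewrite expr0 mul0r -lee_fin -stay_probE msg.1// diracE.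
  by rewrite mem_set.
rewrite exprS -natr1 mulrDl mul1r addrC.
apply: le_trans (stay_probD _ t0 _); last by rewrite mulr_ge0.
by rewrite ler_wpM2l ?stay_prob_ge0.
Qed.

(* Near [0] the bound is the generator at the indicator of [x]; the
   supermultiplicativity of [t |-> p t x {x}] and Bernoulli's inequality
   propagate it to all times. *)
Lemma stay_prob_ge (C : R) (x : T) : 0 <= C -> - C <= G \1_[set x] x ->
  forall t, 0 <= t -> 1 - (C + 1) * t <= stay_prob t x.
Proof.
move=> C0 GC t; rewrite le_eqVlt => /predU1P[<-|t0].
  by have := stay_probMn x 0 (lexx (0 : R)); rewrite expr0 mulr0 mulr0 subr0.
have mf : measurable_fun [set: T] (\1_[set x] : T -> R) by exact: discrete_measurable_fun.
have bf : bounded_fun (\1_[set x] : T -> R).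
  exists 1; split; first exact: num_real.
  move=> B B1 y _ /=; rewrite (le_trans _ (ltW B1))// indicE.
  by case: (y \in _); rewrite ?normr1 ?normr0.
have /cvg_at_rightP Gx := gen mf bf (x := x).
have /Gx : (forall n, 0 < t / n.+1%:R) /\ t / n.+1%:R @[n --> \oo] --> 0.
  split=> [n|]; first by rewrite divr_gt0.
  rewrite -[X in _ --> X](mulr0 t); apply: cvgMr; exact: cvg_harmonic.
(* This tolerance 1 is what turns [C] into [C + 1]. *)
move=> /cvgrPdist_lt /(_ 1 ltr01)/= H.
(* Makes the time step so short that Bernoulli's inequality applies. *)
have : \forall n \near \oo, (C + 1) * t <= n.+1%:R.
  near=> n; rewrite (@le_trans _ _ n%:R)// ?ler_nat//.
  near: n; exact: nbhs_infty_ger.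
move=> H'; have [n [Hn Hn']] := filter_ex (filterI H H').
have n0 : 0 < n.+1%:R :> R by [].
have h0 : 0 < t / n.+1%:R by rewrite divr_gt0.
have small : 1 - (C + 1) * (t / n.+1%:R) <= stay_prob (t / n.+1%:R) x.
  move: Hn; rewrite Rintegral_indic -/(stay_prob _ _) indicE mem_set//=.
  rewrite ltr_distlC => /andP[Hn _].
  have : - (C + 1) <= (t / n.+1%:R)^-1 * (stay_prob (t / n.+1%:R) x - 1) by lra.
  by rewrite ler_pdivlMl//; move: (t / _) => a; lra.
have -> : stay_prob t x = stay_prob (n.+1%:R * (t / n.+1%:R)) x.
  by rewrite mulrC divfK// gt_eqF.
apply: le_trans (stay_probMn _ _ (ltW h0)).
have a01 : 0 <= (C + 1) * (t / n.+1%:R) <= 1.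
  rewrite mulr_ge0 ?(ltW h0)//=; last by lra.
  by rewrite mulrA ler_pdivrMr// mul1r.
have := bernoulli_inequality n.+1 a01.
have -> : n.+1%:R * ((C + 1) * (t / n.+1%:R)) = (C + 1) * t.
  by field; rewrite gt_eqF.
move=> /le_trans; apply; rewrite ler_pXn2r ?nnegrE ?stay_prob_ge0//.
by move: a01; move: (t / _) => a; lra.
Unshelve. all: by end_near. Qed.

(** [f] lies between [f x] times the indicator of [x] and the function equal to [f x] at [x] and [B]
    elsewhere, so only the mass away from [x] matters. The bound does not depend on [x] and later
    dominates the difference quotients. *)
Lemma semigroup_increment_le (f : T -> R) (B C : R) (x : T) :
  (forall y, 0 <= f y <= B) -> 0 <= C -> - C <= G \1_[set x] x ->
  forall t, 0 <= t -> `|\int[p t x]_y f y - f x| <= B * (C + 1) * t.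
Proof.
move=> fB C0 GC t t0.
have B0 : 0 <= B by have /andP[] := fB x; exact: le_trans.
have /andP[fx0 fxB] := fB x.
have fM y : `|f y| <= B by have /andP[? ?] := fB y; rewrite ger0_norm.
have ind01 y : 0 <= (\1_[set x] y : R) <= 1.
  by rewrite indicE; case: (y \in _); rewrite ?lexx ?ler01.
have i1 : (p t x).-integrable setT (EFin \o \1_[set x]).
  by apply: (@bounded_integrable _ _ 1) => y; rewrite ger0_norm; case/andP: (ind01 y).
have if_ := bounded_integrable (p t x) fM.
have lin a b : \int[p t x]_y (a + b * \1_[set x] y) = a + b * stay_prob t x.
  rewrite RintegralD//.
  - by rewrite Rintegral_cst_probability RintegralZl// Rintegral_indic.
  - exact: (@bounded_integrable _ _ `|a|).
  - apply: (@bounded_integrable _ _ `|b|) => y; rewrite normrM ler_piMr//.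
    by rewrite ger0_norm; case/andP: (ind01 y).
have ilin a b : (p t x).-integrable setT (EFin \o (fun y => a + b * \1_[set x] y)).
  apply: (@bounded_integrable _ _ (`|a| + `|b|)) => y.
  rewrite (le_trans (ler_normD _ _))// lerD2l normrM ler_piMr//.
  by rewrite ger0_norm; case/andP: (ind01 y).
have low : f x * stay_prob t x <= \int[p t x]_y f y.
  rewrite -[leLHS]add0r -lin le_Rintegral// => y _.
  rewrite add0r indicE; case: (boolP (y \in _)) => [|_].
    by rewrite inE => /= ->; rewrite mulr1.
  by rewrite mulr0; case/andP: (fB y).
have upp : \int[p t x]_y f y <= B + (f x - B) * stay_prob t x.
  rewrite -lin le_Rintegral// => y _.
  rewrite indicE; case: (boolP (y \in _)) => [|_].
    by rewrite inE => /= ->; rewrite mulr1; lra.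
  by rewrite mulr0 addr0; case/andP: (fB y).
have s1 := stay_prob_le1 t x.
have := stay_prob_ge C0 GC t0 => s2.
have B1 : B * (1 - stay_prob t x) <= B * ((C + 1) * t) by rewrite ler_wpM2l//; lra.
have B2 : f x * (1 - stay_prob t x) <= B * (1 - stay_prob t x).
  by rewrite ler_wpM2r//; lra.
have B3 : 0 <= f x * (1 - stay_prob t x) by rewrite mulr_ge0//; lra.
by rewrite ler_norml; apply/andP; split; lra.
Qed.

Context (pi : probability T R) (inv : invariant_law p pi).

(** With [pi] read as a constant kernel, the double integral is an integral against its composition
    with [p t], which is [pi] by invariance. *)
Lemma invariant_integral (t : R) (f : T -> \bar R) : 0 <= t ->
  (forall x, 0%E <= f x)%E ->
  (\int[pi]_x \int[p t x]_y f y = \int[pi]_x f x)%E.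
Proof.
move=> t0 f0.
have ml : measurable_fun [set: T] (fun _ : T => pi : pprobability T R).
  exact: measurable_cst.
have mk : measurable_fun [set: T * T] (fun xy : T * T => p t xy.2 : pprobability T R).
  apply: (@measurableT_comp _ _ _ _ _ _ (fun x => p t x : pprobability T R)).
    exact: discrete_measurable_fun.
  exact: measurable_snd.
have := @integral_kcomp _ _ _ _ _ _ R (kprobability ml) (kprobability mk) point f f0
  (@discrete_measurable_fun _ _ _ _).
rewrite /kprobability /= => <-.
apply: eq_measure_integral => A mA _ /=.
by rewrite /kcomp /=; exact: inv.
Qed.

(** By invariance the difference quotients at times [1 / (n + 1)] have mean 0. They converge
    pointwise to [G f], and the uniform bound [C] on the exit rates keeps them bounded, so dominated
    convergence applies. *)
Theorem basic_adjoint_relation (f : T -> R) (B C : R) :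
  (forall y, 0 <= f y <= B) -> 0 <= C ->
  (forall x, - C <= G \1_[set x] x) ->
  (forall x, `|G f x| <= B * (C + 1)) /\ \int[pi]_x G f x = 0.
Proof.
move=> fB C0 GC.
have B0 : 0 <= B by have /andP[] := fB point; exact: le_trans.
have fM y : `|f y| <= B by have /andP[? ?] := fB y; rewrite ger0_norm.
have mf : measurable_fun [set: T] f by exact: discrete_measurable_fun.
have bf : bounded_fun f.
  exists B; split; first exact: num_real.
  by move=> b Bb y _; exact: le_trans (fM y) (ltW Bb).
pose h n := n.+1%:R^-1 : R.
have h0 n : 0 < h n by rewrite invr_gt0.
pose g n x := (h n)^-1 * (\int[p (h n) x]_y f y - f x).
have gcvg x : g n x @[n --> \oo] --> G f x.
  have /cvg_at_rightP := gen mf bf (x := x); apply; split => //.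
  exact: cvg_harmonic.
have gB n x : `|g n x| <= B * (C + 1).
  rewrite normrM gtr0_norm ?invr_gt0// ler_pdivrMl// mulrC.
  exact: semigroup_increment_le (ltW _).
have GB x : `|G f x| <= B * (C + 1).
  have /cvg_norm gn := gcvg x.
  by apply: (cvgr_to_le gn); exact: nearW.
split => //.
have Pf01 n x : 0 <= \int[p (h n) x]_y f y <= B.
  rewrite Rintegral_ge0 => [|y _]; last by case/andP: (fB y).
  rewrite -[leRHS](Rintegral_cst_probability (p (h n) x)) le_Rintegral//.
  - exact: bounded_integrable fM.
  - by apply: (@bounded_integrable _ _ `|B|) => y.
  - by move=> y _; case/andP: (fB y).
have PfM n x : `|\int[p (h n) x]_y f y| <= B.
  by have /andP[? ?] := Pf01 n x; rewrite ger0_norm.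
have g0 n : \int[pi]_x g n x = 0.
  rewrite RintegralZl//; last first.
    apply: (@bounded_integrable _ _ (B + B)) => x.
    by rewrite (le_trans (ler_normB _ _))// lerD.
  rewrite RintegralB//; [|exact: bounded_integrable (PfM n)|exact: bounded_integrable fM].
  apply/eqP; rewrite mulf_eq0 subr_eq0; apply/orP; right; apply/eqP.
  apply: EFin_inj.
  rewrite -(integral_EFin_Rintegral _ (PfM n)) -(integral_EFin_Rintegral _ fM).
  rewrite -(@invariant_integral (h n) (fun x => (f x)%:E)) ?ltW//.
    by apply: eq_integral => x _; rewrite -(integral_EFin_Rintegral _ fM).
  by move=> x; rewrite lee_fin; case/andP: (fB x).
have gcvgE x : (g n x)%:E @[n --> \oo] --> (G f x)%:E.
  by apply: cvg_EFin; [exact: nearW|exact: gcvg].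
have [|||||_ _] := @dominated_convergence _ _ R pi setT measurableT
  (fun n x => (g n x)%:E) (fun x => (G f x)%:E) (fun=> (B * (C + 1))%:E).
- by move=> n; exact: discrete_measurable_fun.
- exact: discrete_measurable_fun.
- by apply: aeW => x _; exact: gcvgE.
- exact: (bounded_integrable pi (fun=> lexx `|B * (C + 1)|)).
- by apply: aeW => x n _; exact: gB.
rewrite (_ : (fun n => _) = fun=> 0%:E); last first.
  apply/funext => n /=.
  by rewrite (integral_EFin_Rintegral _ (gB n)) g0.
rewrite (integral_EFin_Rintegral _ GB) => /(cvg_unique _ (cvg_cst _)).
by move=> /(_ (@ereal_hausdorff _)) -[].
Qed.

End BasicAdjointRelation.

(** * Exponential moments from negative drift *)

(** From [expR (- x) >= 1 - x] the left side is at most [1 / (1 - x)], and [(1 + x + 2 * x ^+ 2) *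
    (1 - x) - 1 = x ^+ 2 * (1 - 2 * x)]. *)
Lemma expR_le_quadratic (R : realType) (x : R) : `|x| <= 2^-1 ->
  expR x <= 1 + x + 2 * x ^+ 2.
Proof.
rewrite ler_norml => /andP[x1 x2].
have e1 := expR_ge1Dx (- x).
have x3 : 0 < 1 - x by lra.
have -> : expR x = (expR (- x))^-1 by rewrite expRN invrK.
apply: (@le_trans _ _ (1 - x)^-1); first by rewrite lef_pV2 ?posrE ?expR_gt0.
rewrite -[X in X <= _]mul1r ler_pdivrMr//.
have := sqr_ge0 x => x20; have : 0 <= x ^+ 2 * (1 - 2 * x) by rewrite mulr_ge0//; lra.
lra.
Qed.

Section ExponentialMoment.
Import numFieldNormedType.Exports.
Local Open Scope classical_set_scope.
Context (d : measure_display) (T : measurableType d) (R : realType).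
Context (discreteT : forall A : set T, measurable A).
Context (E : finType) (rate_bound kappa eps B : R).
Context (rate_bound_ge0 : 0 <= rate_bound) (kappa_ge0 : 0 <= kappa).
Context (eps_gt0 : 0 < eps).

Let rk := rate_bound * kappa ^+ 2.

Let rk_ge0 : 0 <= rk. Proof. by rewrite mulr_ge0// sqr_ge0. Qed.

(** The first bound puts exponents of single jumps in the range of [expR_le_quadratic]; the second
    lets the second-order term consume at most half of the drift. Adding 1 avoids zero
    denominators. *)
Definition exp_rate : R := Num.min (2 * (kappa + 1))^-1 (eps / (4 * (rk + 1))).

Lemma exp_rate_gt0 : 0 < exp_rate.
Proof.
have k0 := kappa_ge0; have rk0 := rk_ge0.
by rewrite lt_min invr_gt0 divr_gt0 ?andbT//; lra.
Qed.

Lemma exp_rate_jump : exp_rate * kappa <= 2^-1.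
Proof.
have t0 := exp_rate_gt0; have k0 := kappa_ge0.
have : exp_rate <= (2 * (kappa + 1))^-1 by rewrite ge_min lexx.
rewrite -[X in _ <= X]mul1r ler_pdivlMr; [|by lra].
lra.
Qed.

Lemma exp_rate_drift : 2 * exp_rate * rk <= eps / 2.
Proof.
have t0 := exp_rate_gt0; have k0 := rk_ge0.
have : exp_rate <= eps / (4 * (rk + 1)) by rewrite ge_min lexx orbT.
rewrite ler_pdivlMr; [|by lra].
lra.
Qed.

Definition exp_slope : R := exp_rate * eps / 2.

(** Covers the states with [y x < B], where the exponential is at most [expR (exp_rate * B)] and the
    drift of [y] at most [rate_bound * kappa]. *)
Definition exp_const : R :=
  expR (exp_rate * B) *
    (exp_rate * (rate_bound * kappa) + 2 * exp_rate ^+ 2 * rk + exp_slope).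

Lemma exp_slope_gt0 : 0 < exp_slope.
Proof. by rewrite divr_gt0// mulr_gt0// exp_rate_gt0. Qed.

Lemma exp_const_gt0 : 0 < exp_const.
Proof.
rewrite mulr_gt0 ?expR_gt0// ltr_wpDl ?exp_slope_gt0//.
by rewrite addr_ge0 ?mulr_ge0 ?sqr_ge0 ?(ltW exp_rate_gt0).
Qed.

Context (c : E -> T -> R) (tau : E -> T -> T) (y : T -> R).
Context (c_ge0 : forall e x, 0 <= c e x).
Context (sum_c : forall x, \sum_e c e x <= rate_bound).
Context (jump_y : forall e x, `|y (tau e x) - y x| <= kappa).
Context (drift_y : forall x, B <= y x -> jump_generator c tau y x <= - eps).

Let f x := expR (exp_rate * y x).

(** A second-order expansion bounds the drift of [f] by [f x] times
    [exp_rate * g + 2 * exp_rate ^+ 2 * rk]. Above level [B] this factor is at most [- exp_slope];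
    below it everything is bounded and goes into [exp_const]. *)
Lemma exp_drift x :
  jump_generator c tau f x <= exp_const - exp_slope * f x.
Proof.
have t0 := exp_rate_gt0; have f0 : 0 < f x := expR_gt0 _.
set g := jump_generator c tau y x.
have step e : c e x * (f (tau e x) - f x) <=
    f x * (exp_rate * (c e x * (y (tau e x) - y x)) +
           c e x * (2 * exp_rate ^+ 2 * kappa ^+ 2)).
  have fE : f (tau e x) = f x * expR (exp_rate * (y (tau e x) - y x)).
    by rewrite /f -expRD; congr expR; ring.
  set D := y (tau e x) - y x in fE *.
  have De : expR (exp_rate * D) <= 1 + exp_rate * D + 2 * (exp_rate * D) ^+ 2.
    apply: expR_le_quadratic; rewrite normrM gtr0_norm//.
    by rewrite (le_trans _ exp_rate_jump)// ler_wpM2l ?(ltW t0)//; exact: jump_y.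
  have D2 : D ^+ 2 <= kappa ^+ 2.
    rewrite -[D ^+ 2]real_normK ?num_real// ler_pXn2r ?nnegrE//.
    exact: jump_y.
  have De' : expR (exp_rate * D) - 1 <=
      exp_rate * D + 2 * exp_rate ^+ 2 * kappa ^+ 2.
    have : exp_rate ^+ 2 * D ^+ 2 <= exp_rate ^+ 2 * kappa ^+ 2.
      by rewrite ler_wpM2l// sqr_ge0.
    move: De; rewrite exprMn; lra.
  have -> : c e x * (f (tau e x) - f x) =
      f x * (c e x * (expR (exp_rate * D) - 1)) by rewrite fE; ring.
  rewrite ler_pM2l//; have := ler_wpM2l (c_ge0 e x) De'; lra.
have Gf : jump_generator c tau f x <=
    f x * (exp_rate * g + 2 * exp_rate ^+ 2 * rk).
  apply: (le_trans (ler_sum _ (fun e _ => step e))).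
  rewrite -mulr_sumr ler_pM2l// big_split/= -mulr_sumr lerD2l -mulr_suml /rk.
  have := ler_wpM2r (_ : 0 <= 2 * exp_rate ^+ 2 * kappa ^+ 2) (sum_c x).
  move=> /(_ _)/le_trans; apply; last by lra.
  by rewrite mulr_ge0 ?sqr_ge0// mulr_ge0 ?sqr_ge0.
apply: (le_trans Gf); have td := exp_rate_drift.
have [By|yB] := leP B (y x).
  have : exp_rate * g + 2 * exp_rate ^+ 2 * rk <= - exp_slope.
    have := ler_wpM2l (ltW t0) (drift_y By).
    have := ler_wpM2l (ltW t0) td; rewrite /exp_slope -/g; lra.
  move=> /(ler_wpM2l (ltW f0)); have := exp_const_gt0; lra.
have fB : f x <= expR (exp_rate * B).
  by rewrite ler_expR ler_wpM2l// ltW.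
have gB : g <= rate_bound * kappa.
  rewrite /g /jump_generator.
  apply: (@le_trans _ _ (\sum_e c e x * kappa)).
    apply: ler_sum => e _; rewrite ler_wpM2l//.
    by rewrite (le_trans (ler_norm _))// jump_y.
  by rewrite -mulr_suml ler_wpM2r.
rewrite lerBrDr -[X in _ + X]mulrC -mulrDr /exp_const.
set K := _ + exp_slope.
have K0 : 0 <= exp_rate * (rate_bound * kappa) + 2 * exp_rate ^+ 2 * rk + exp_slope.
  by rewrite !addr_ge0 ?mulr_ge0 ?sqr_ge0 ?(ltW t0)// ltW// exp_slope_gt0.
apply: (@le_trans _ _ (f x *
  (exp_rate * (rate_bound * kappa) + 2 * exp_rate ^+ 2 * rk + exp_slope))).
  by rewrite ler_pM2l// /K !lerD2r ler_wpM2l// ltW.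
by rewrite ler_wpM2r.
Qed.

Context (pi : probability T R).
Context (stat : stationary_distribution (jump_generator c tau) pi).

(* Truncating at [n] only loses mass upwards: a jump from [f x >= n] cannot
   increase [min (f, n)], and one from [f x < n] increases it no more than [f]. *)
Lemma exp_drift_truncated n x :
  exp_slope * (f x * (f x < n%:R)%R%:R) <=
  exp_const - jump_generator c tau (fun x' => Num.min (f x') n%:R) x.
Proof.
rewrite lerBrDr -lerBrDl; case: ltP => [fn|nf].
  rewrite mulr1 (le_trans _ (exp_drift x))//; apply: ler_sum => e _.
  rewrite ler_wpM2l// (min_idPl (ltW fn)) lerD2r ge_min lexx//.
rewrite !mulr0 subr0 (le_trans _ (ltW exp_const_gt0))//.
apply: sumr_le0 => e _; rewrite mulr_ge0_le0//.
by rewrite (min_idPr nf) subr_le0 ge_min lexx orbT.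
Qed.

(** [exp_drift_truncated] is integrated against [pi]: the truncation is bounded, so its generator
    has mean 0. *)
Lemma exp_moment_truncated n :
  (\int[pi]_x (f x * (f x < n%:R)%R%:R)%:E <= (exp_const / exp_slope)%:E)%E.
Proof.
have [p [msg gen inv]] := stat.
pose fn x := Num.min (f x) n%:R.
have fn01 x : 0 <= fn x <= n%:R.
  by rewrite /fn le_min expR_ge0 ler0n ge_min lexx orbT.
(* The exit rate from [x] is at most the sum of all rates, which gives the constant required by
   [basic_adjoint_relation]. *)
have ind x : - rate_bound <= jump_generator c tau \1_[set x] x.
  rewrite lerNl (le_trans _ (sum_c x))// -sumrN ler_sum// => e _.
  by rewrite -mulrN -[leRHS]mulr1 ler_wpM2l.
have [GB G0] := basic_adjoint_relation discreteT msg gen inv fn01 rate_bound_ge0 ind.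
have fM x : `|f x * (f x < n%:R)%R%:R| <= n%:R.
  have f0 : 0 < f x := expR_gt0 _.
  by case: ltP => [fn'|_]; rewrite ?mulr1 ?mulr0 ?normr0// gtr0_norm// ltW.
rewrite (integral_EFin_Rintegral discreteT _ fM) lee_fin.
rewrite ler_pdivlMr ?exp_slope_gt0// mulrC -RintegralZl//; last first.
  exact: bounded_integrable fM.
apply: (@le_trans _ _ (\int[pi]_x (exp_const - jump_generator c tau fn x))).
  apply: le_Rintegral => //.
  - apply: (@bounded_integrable _ _ _ discreteT _ _ (exp_slope * n%:R)) => x.
    by rewrite normrM gtr0_norm ?exp_slope_gt0// ler_pM2l ?exp_slope_gt0.
  - apply: (@bounded_integrable _ _ _ discreteT _ _
      (exp_const + n%:R * (rate_bound + 1))) => x.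
    rewrite (le_trans (ler_normB _ _))// lerD//.
    by rewrite gtr0_norm ?exp_const_gt0.
  - by move=> x _; exact: exp_drift_truncated.
rewrite RintegralB//.
- by rewrite G0 subr0 Rintegral_cst_probability.
- exact: (@bounded_integrable _ _ _ discreteT _ _ `|exp_const|).
- exact: (bounded_integrable discreteT pi GB).
Qed.

Theorem exp_moment_le :
  (\int[pi]_x (expR (exp_rate * y x))%:E <= (exp_const / exp_slope)%:E)%E.
Proof.
pose g n x : \bar R := (f x * (f x < n%:R)%R%:R)%:E.
have gnd x : {homo g ^~ x : m n / (m <= n)%N >-> (m <= n)%E}.
  move=> m n mn; rewrite /g lee_fin ler_wpM2l ?expR_ge0//.
  case: ltP => [fm|_]; last by case: ltP.
  by rewrite (lt_le_trans fm) ?ler_nat.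
have g0 n x : (0 <= g n x)%E by rewrite lee_fin mulr_ge0 ?expR_ge0.
have limg x : limn (g ^~ x) = (f x)%:E.
  apply/cvg_lim => //; apply: cvg_near_cst.
  near=> n; rewrite /g.
  have -> : f x < n%:R by near: n; exact: nbhs_infty_gtr.
  by rewrite mulr1.
have gcvg : (\int[pi]_x g n x @[n --> \oo] --> \int[pi]_x limn (g ^~ x))%E.
  apply: cvg_monotone_convergence => //.
  by move=> n; exact: discrete_measurable_fun.
rewrite (eq_integral (fun x => limn (g ^~ x))); last by move=> x _; rewrite limg.
rewrite -(cvg_lim _ gcvg)//; apply: lime_le; first by apply/cvg_ex; eexists; exact: gcvg.
by apply: nearW => n; exact: exp_moment_truncated.
Unshelve. all: by end_near. Qed.

End ExponentialMoment.

(** * State space collapse *)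

Lemma expn_le_expR (R : realType) (n : nat) (theta y : R) : 0 < theta -> 0 <= y ->
  y ^+ n <= n`!%:R / theta ^+ n * expR (theta * y).
Proof.
move=> t0 y0; rewrite mulrAC ler_pdivlMr ?exprn_gt0// -exprMn mulrC.
have x0 : 0 <= theta * y by rewrite mulr_ge0// ltW.
rewrite -ler_pdivrMl ?ltr0n ?fact_gt0// [_^-1 * _]mulrC.
(* The bound by a single term of the exponential series is available for positive powers; power 0 is
   [1 <= expR (theta * y)]. *)
case: n => [|n]; last first.
  by apply: le_trans (expR_ge1Dxn n x0); rewrite lerDr.
by rewrite expr0 fact0 divr1 -expR0 ler_expR.
Qed.

(** With at least one server both positions lie inside the sorted list, so [nth] returns actual
    scaled workloads and not its default 0. *)
Lemma ordered_workload_spread (R : realType) (S : parallel_server_system R)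
    (u : 'I_(nserver S) -> R) (z : state S) : (0 < nserver S)%N ->
  0 <= ordered_workload u (nserver S) z - ordered_workload u 1 z /\
  exists k k', ordered_workload u (nserver S) z - ordered_workload u 1 z =
    scaled_workload u z k - scaled_workload u z k'.
Proof.
move=> K0; rewrite /ordered_workload.
set s := [seq _ | k <- _].
have sz : size (sort <=%R s) = nserver S by rewrite size_sort size_map size_enum_ord.
have lt1 : ((nserver S).-1 < size (sort <=%R s))%N by rewrite sz prednK.
have lt0 : (0 < size (sort <=%R s))%N by rewrite sz.
have val i : (i < size (sort <=%R s))%N ->
    exists k, nth 0 (sort <=%R s) i = scaled_workload u z k.
  move=> /(mem_nth 0); rewrite mem_sort => /mapP[k _ ->]; by exists k.
split; last first.
  have [k ->] := val _ lt1; have [k' ->] := val _ lt0; by exists k, k'.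
rewrite subr_ge0.
exact: (sorted_leq_nth le_trans le_refl 0 (sort_le_sorted s)).
Qed.

Theorem proposition6p1 (R : realType) (S : parallel_server_system R)
    (v : 'I_(nclass S) -> R) (u : 'I_(nserver S) -> R)
    (P : scheduling_policy S)
    (hRHT : relaxed_heavy_traffic S)
    (hRCRP : relaxed_complete_resource_pooling S)
    (hdual : dual_optimal v u) :
  exists2 r0 : R, 0 < r0 < 1 &
  forall n : nat, exists2 M : R, 0 < M &
  forall r : R, 0 < r < r0 ->
  forall pi : probability (state S) R,
    stationary_distribution (wwta_generator P r) pi ->
    ('E_pi[fun z => ((ordered_workload u (nserver S) z
                      - ordered_workload u 1 z) ^+ n)%R] <= M%:E)%E.
Proof.
have u_gt0 := dual_server_gt0 hRCRP hdual.
have [C C0 dist_slack] := scaled_workload_dist_slack hRCRP hdual.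
have C1 : 0 < 2 * (1 + C) by lra.
have r0_lt1 : (2 * (1 + C))^-1 < 1 by rewrite invf_lt1//; lra.
(* Without servers [\sum_k u k] would be 0 instead of 1. *)
have K0 : (0 < nserver S)%N.
  have := sum_u hRHT hdual; rewrite lt0n; apply: contraPneq => K0.
  rewrite big1 => [/esym/eqP|[k +] _]; first by rewrite oner_eq0.
  by move=> lk; exfalso; rewrite K0 in lk.
pose kappa := jump_bound S.
have kappa0 : 0 <= kappa.
  rewrite sumr_ge0// => a _; rewrite addr_ge0 ?sqr_ge0// mulr_ge0//.
  exact/ltW/mean_service_gt0.
have rate0 : 0 <= total_rate S.
  by rewrite sumr_ge0// => a _; rewrite addr_ge0// ltW// ?arrival_gt0 ?service_gt0.
have eps0 : 0 < (4 * C)^-1 by rewrite invr_gt0 mulr_gt0.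
pose B := 2 + 2 * C * drift_const S.
pose theta := exp_rate (total_rate S) kappa (4 * C)^-1.
have theta0 : 0 < theta := exp_rate_gt0 rate0 kappa0 eps0.
pose L : R := 1 + 2 * \sum_j (u j)^-1.
have L0 : 0 < L.
  by rewrite ltr_wpDr// mulr_ge0// sumr_ge0// => j _; rewrite invr_ge0 ltW.
(* The threshold of [potential_drift], fixed before [n] is introduced. *)
exists (2 * (1 + C))^-1; first by rewrite invr_gt0 C1.
move=> n.
(* [L] compares the spread with the potential, and the second factor compares the power of the
   potential with its exponential. *)
pose A := L ^+ n * (n`!%:R / theta ^+ n).
have A0 : 0 < A.
  by rewrite mulr_gt0 ?exprn_gt0// divr_gt0 ?exprn_gt0// ltr0n fact_gt0.
pose M := exp_const (total_rate S) kappa (4 * C)^-1 B /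
  exp_slope (total_rate S) kappa (4 * C)^-1.
have M0 : 0 < M.
  by rewrite divr_gt0 ?exp_slope_gt0 ?exp_const_gt0.
exists (A * M); first exact: mulr_gt0.
move=> r r0 pi stat.
have r01 : 0 < r < 1 by case/andP: r0 => -> /lt_trans ->.
have GE : wwta_generator P r = jump_generator (jump_rate P r) (@jump R S).
  by apply/funext => f; apply/funext => z; exact: wwta_generatorE.
rewrite GE in stat.
have discr (X : set (state S)) : measurable X by [].
have := exp_moment_le discr rate0 kappa0 eps0
  (fun e z => jump_rate_ge0 P e z r01) (fun z => sum_jump_rate_le P z r01)
  (potential_jump hRHT hdual)
  (fun z => potential_drift P hRHT hdual u_gt0 C0 dist_slack r0) stat.
rewrite -/M -/theta => expM.
rewrite unlock.
apply: (@le_trans _ _ (\int[pi]_z (A * expR (theta * potential u z))%:E)%E).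
  apply: ge0_le_integral => //.
  - move=> z _; rewrite lee_fin exprn_ge0//.
    by have [] := ordered_workload_spread u z K0.
  - move=> z _; rewrite lee_fin.
    have [D0 [k [k' DE]]] := ordered_workload_spread u z K0.
    have y1 := potential_ge1 u z.
    have DL := dist_le_potential u_gt0 z k k'.
    apply: (@le_trans _ _ ((L * potential u z) ^+ n)).
      apply: lerXn2r; rewrite ?nnegrE// ?mulr_ge0 ?(ltW L0)//; first by lra.
      by rewrite DE (le_trans (ler_norm _)).
    rewrite exprMn /A -mulrA ler_pM2l ?exprn_gt0//.
    by apply: expn_le_expR => //; lra.
under eq_integral do rewrite EFinM.
rewrite ge0_integralZl_EFin ?(ltW A0)//.
by rewrite (EFinM A M) lee_pmul2l.
Qed.
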